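(* Let $R=(R^{\lambda\alpha}_{\beta\mu})$ be a family of complex numbers indexed by $\lambda,\mu\in\{1,\dots,N_1\}$ and $\alpha,\beta\in\{1,\dots,N_2\}$, and set $\hat R^{\lambda\alpha}_{\mu\beta}=R^{\lambda\alpha}_{\beta\mu}$. The relations $$x_1^\lambda x_1^\mu=x_1^\mu x_1^\lambda,\quad x_2^\alpha x_2^\beta=x_2^\beta x_2^\alpha,\quad x_1^\lambda x_2^\alpha=R^{\lambda\alpha}_{\beta\mu}x_2^\beta x_1^\mu,\quad x_2^\alpha x_1^\lambda=\overline{R}^{\lambda\alpha}_{\beta\mu}x_1^\mu x_2^\beta$$ define (the algebra of) a noncommutative product of the Euclidean space $\mathbb{R}^{N_1}$ with the Euclidean space $\mathbb{R}^{N_2}$ if and only if $\hat R$ admits a representation $$\hat R=\sum_{r=1}^pA_r\otimes B_r+i\sum_{a=1}^qC_a\otimes D_a,$$ with the $A_r$ real symmetric $N_1\times N_1$ matrices, the $B_r$ real symmetric $N_2\times N_2$ matrices, the $C_a$ real antisymmetric $N_1\times N_1$ matrices, the $D_a$ real antisymmetric $N_2\times N_2$ matrices, each of the families $(A_r)$, $(B_r)$, $(C_a)$, $(D_a)$ being linearly independent, satisfying $$[A_r,A_s]=0,\quad[A_r,C_a]=0,\quad[C_a,C_b]=0,$$ $$[B_r,B_s]=0,\quad[B_r,D_a]=0,\quad[D_a,D_b]=0$$ for all $r,s\in\{1,\dots,p\}$, $a,b\in\{1,\dots,q\}$, and the normalization condition $$S^2+T^2=1_{N_1}\otimes1_{N_2},\qquad\text{where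 } S=\sum_{r=1}^pA_r\otimes B_r,\quad T=\sum_{a=1}^qC_a\otimes D_a .$$
   Context: Indices $\lambda,\mu,\nu,\rho$ run in $\{1,\dots,N_1\}$; indices $\alpha,\beta,\gamma,\delta$ run in $\{1,\dots,N_2\}$; summation over repeated up-down indices is understood and relations hold for all values of the free indices; $\overline{R}^{\lambda\alpha}_{\beta\mu}$ is the complex conjugate of $R^{\lambda\alpha}_{\beta\mu}$. In the representation of $\hat R$, $\hat R^{\lambda\alpha}_{\mu\beta}$ is the matrix element with row index $(\lambda,\alpha)$ and column index $(\mu,\beta)$, so $(A\otimes B)^{\lambda\alpha}_{\mu\beta}=A^\lambda_\mu B^\alpha_\beta$. The sums may be empty ($p=0$ or $q=0$). $\mathcal{A}_R$ denotes the complex quadratic $*$-algebra generated by hermitian elements $x_1^\lambda,x_2^\alpha$ with the displayed relations. By definition, these relations define (the algebra $\mathcal{A}_R$ of) a noncommutative product of the Euclidean spaces $\mathbb{R}^{N_1}$ and $\mathbb{R}^{N_2}$ when $R$ satisfies all of the following: (1) reality: $\overline{R}^{\lambda\alpha}_{\beta\mu}R^{\mu\beta}_{\gamma\nu}=\delta^\lambda_\nu\delta^\alpha_\gamma$; (2) Yang–Baxter conditions: $R^{\lambda\alpha}_{\gamma\rho}R^{\rho\beta}_{\delta\mu}=R^{\lambda\beta}_{\delta\rho}R^{\rho\alpha}_{\gamma\mu}$, $\ \overline{R}^{\lambda\alpha}_{\gamma\rho}\overline{R}^{\rho\beta}_{\delta\mu}=\overline{R}^{\lambda\beta}_{\delta\rho}\overline{R}^{\rho\alpha}_{\gamma\mu}$,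 $\ \overline{R}^{\lambda\alpha}_{\gamma\rho}R^{\rho\beta}_{\delta\mu}=R^{\lambda\beta}_{\delta\rho}\overline{R}^{\rho\alpha}_{\gamma\mu}$, and $R^{\lambda\alpha}_{\gamma\nu}R^{\mu\gamma}_{\beta\rho}=R^{\mu\alpha}_{\gamma\rho}R^{\lambda\gamma}_{\beta\nu}$, $\ \overline{R}^{\lambda\alpha}_{\gamma\nu}\overline{R}^{\mu\gamma}_{\beta\rho}=\overline{R}^{\mu\alpha}_{\gamma\rho}\overline{R}^{\lambda\gamma}_{\beta\nu}$, $\ R^{\lambda\alpha}_{\gamma\nu}\overline{R}^{\mu\gamma}_{\beta\rho}=\overline{R}^{\mu\alpha}_{\gamma\rho}R^{\lambda\gamma}_{\beta\nu}$; (3) centrality: $\sum_{\lambda=1}^{N_1}R^{\lambda\gamma}_{\beta\nu}R^{\lambda\beta}_{\alpha\mu}=\delta^\gamma_\alpha\delta_{\mu\nu}$ and $\sum_{\alpha=1}^{N_2}R^{\lambda\alpha}_{\beta\rho}R^{\rho\alpha}_{\gamma\mu}=\delta^\lambda_\mu\delta_{\beta\gamma}$ (given (1) and (2), this is equivalent to the centrality of $\sum_\lambda(x_1^\lambda)^2+\sum_\alpha(x_2^\alpha)^2$ in $\mathcal{A}_R$). *)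

(* Defs.v *)
From HB Require Import structures.
From mathcomp Require Import all_boot all_order all_algebra.
From mathcomp Require Import reals.
From mathcomp.real_closed Require Import complex mxtens.

Set Implicit Arguments.
Unset Strict Implicit.
Unset Printing Implicit Defensive.

Import Order.TTheory GRing.Theory Num.Theory.
Local Open Scope ring_scope.
Local Open Scope complex_scope.

(* Arguments are ordered as the indices of R^{lam alp}_{bet mu} are read, upper
   ones first: [P lam alp bet mu] stands for P^{lam alp}_{bet mu}.
   No positivity of N1, N2 is required. *)
Definition coeff_family (R : realType) (N1 N2 : nat) : Type :=
  'I_N1 -> 'I_N2 -> 'I_N2 -> 'I_N1 -> R[i].

Definition conj_coeff (R : realType) (N1 N2 : nat) (P : coeff_family R N1 N2) :
    coeff_family R N1 N2 :=
  fun lam alp bet mu => (P lam alp bet mu)^*.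

Definition reality (R : realType) (N1 N2 : nat) (P : coeff_family R N1 N2) :
    Prop :=
  forall (lam nu : 'I_N1) (alp gam : 'I_N2),
    \sum_(mu < N1) \sum_(bet < N2)
       conj_coeff P lam alp bet mu * P mu bet gam nu
    = (lam == nu)%:R * (alp == gam)%:R.

(* P^{lam alp}_{gam rho} Q^{rho bet}_{del mu}
   = Q^{lam bet}_{del rho} P^{rho alp}_{gam mu}, summed over rho. *)
Definition yang_baxter1 (R : realType) (N1 N2 : nat)
    (P Q : coeff_family R N1 N2) : Prop :=
  forall (lam mu : 'I_N1) (alp bet gam del : 'I_N2),
    \sum_(rho < N1) P lam alp gam rho * Q rho bet del mu
    = \sum_(rho < N1) Q lam bet del rho * P rho alp gam mu.

(* P^{lam alp}_{gam nu} Q^{mu gam}_{bet rho}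
   = Q^{mu alp}_{gam rho} P^{lam gam}_{bet nu}, summed over gam. *)
Definition yang_baxter2 (R : realType) (N1 N2 : nat)
    (P Q : coeff_family R N1 N2) : Prop :=
  forall (lam mu nu rho : 'I_N1) (alp bet : 'I_N2),
    \sum_(gam < N2) P lam alp gam nu * Q mu gam bet rho
    = \sum_(gam < N2) Q mu alp gam rho * P lam gam bet nu.

Definition yang_baxter (R : realType) (N1 N2 : nat) (P : coeff_family R N1 N2) :
    Prop :=
  [/\ yang_baxter1 P P,
      yang_baxter1 (conj_coeff P) (conj_coeff P)
    & yang_baxter1 (conj_coeff P) P] /\
  [/\ yang_baxter2 P P,
      yang_baxter2 (conj_coeff P) (conj_coeff P)
    & yang_baxter2 P (conj_coeff P)].

Definition centrality (R : realType) (N1 N2 : nat) (P : coeff_family R N1 N2) :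
    Prop :=
  (forall (gam alp : 'I_N2) (nu mu : 'I_N1),
     \sum_(lam < N1) \sum_(bet < N2) P lam gam bet nu * P lam bet alp mu
     = (gam == alp)%:R * (mu == nu)%:R) /\
  (forall (lam mu : 'I_N1) (bet gam : 'I_N2),
     \sum_(alp < N2) \sum_(rho < N1) P lam alp bet rho * P rho alp gam mu
     = (lam == mu)%:R * (bet == gam)%:R).

(* The quadratic *-algebra generated by hermitian x1^lam, x2^alp with
     x1^lam x1^mu = x1^mu x1^lam,   x2^alp x2^bet = x2^bet x2^alp,
     x1^lam x2^alp = P^{lam alp}_{bet mu} x2^bet x1^mu,
     x2^alp x1^lam = conj(P^{lam alp}_{bet mu}) x1^mu x2^bet
   is by definition (the algebra of) a noncommutative product of the Euclidean
   spaces of dimensions N1 and N2 when its coefficients P satisfy the following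
   conditions; the definition does not otherwise refer to the algebra. *)
Definition noncommutative_euclidean_product
    (R : realType) (N1 N2 : nat) (P : coeff_family R N1 N2) : Prop :=
  [/\ reality P, yang_baxter P & centrality P].

(* Rows and columns of [tensmx] are indexed through [mxtens_index], so that
   (A *t B) at row (lam, alp), column (mu, bet) is A lam mu * B alp bet. *)
Definition hat (R : realType) (N1 N2 : nat) (P : coeff_family R N1 N2) :
    'M[R[i]]_(N1 * N2) :=
  \matrix_(k, l)
     (let: (lam, alp) := mxtens_unindex k in
      let: (mu, bet) := mxtens_unindex l in P lam alp bet mu).

Definition real_mx_to_complex (R : realType) (n : nat) (M : 'M[R]_n) :
    'M[R[i]]_n :=
  map_mx (real_complex R) M.

Definition symmetric_mx (R : realType) (n : nat) (M : 'M[R]_n) : Prop :=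
  M^T = M.

Definition antisymmetric_mx (R : realType) (n : nat) (M : 'M[R]_n) : Prop :=
  M^T = - M.

Definition linearly_independent
    (R : realType) (n p : nat) (M : 'I_p -> 'M[R]_n) : Prop :=
  free [tuple M r | r < p].

(* Main.v *)
Require Import Defs.
From HB Require Import structures.
From mathcomp Require Import all_boot all_order all_algebra.
From mathcomp Require Import reals.
From mathcomp.real_closed Require Import complex mxtens.

Set Implicit Arguments.
Unset Strict Implicit.
Unset Printing Implicit Defensive.

Import Order.TTheory GRing.Theory Num.Theory.
Local Open Scope ring_scope.
Local Open Scope complex_scope.

(** Read R as a matrix with values in matrices: freezing (alp, bet) or (lam, mu)
    gives slices in M_N1 or M_N2. The Yang-Baxter conditions say exactly that
    the slices of R and of its conjugate commute, i.e. that those of Re R and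
    Im R do. Reality says that the inverse of hat R is its conjugate, and
    centrality that its inverse is also each of its two partial transposes; so
    the slices of Re R are symmetric and those of Im R antisymmetric, and what
    is left of reality is S^2 + T^2 = 1, since [S, T] = 0 follows from the
    commutation of slices. Finally, a tensor of minimal rank has factors in the
    span of its slices, which therefore inherit symmetry and commutation;
    conversely, slices are combinations of the factors. *)

(** * Four-index families as matrices on a tensor product, and their slices *)

Section FlatMatrix.

Variables (N1 N2 : nat).

Definition slice1 (T : Type) (K : 'I_N1 -> 'I_N2 -> 'I_N2 -> 'I_N1 -> T)
    (alp bet : 'I_N2) : 'M[T]_N1 :=
  \matrix_(lam, mu) K lam alp bet mu.

Definition slice2 (T : Type) (K : 'I_N1 -> 'I_N2 -> 'I_N2 -> 'I_N1 -> T)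
    (lam mu : 'I_N1) : 'M[T]_N2 :=
  \matrix_(alp, bet) K lam alp bet mu.

(** The same arrangement as [hat], but with entries in any type, so that it also applies to the real
    and imaginary parts. The upper indices form the row, and the lower ones are swapped to form the
    column [(mu, bet)]. *)
Definition flat_mx (T : Type) (K : 'I_N1 -> 'I_N2 -> 'I_N2 -> 'I_N1 -> T) :
    'M[T]_(N1 * N2) :=
  \matrix_(k, l) K (mxtens_unindex k).1 (mxtens_unindex k).2
                   (mxtens_unindex l).2 (mxtens_unindex l).1.

Lemma flat_mxE (T : Type) (K : 'I_N1 -> 'I_N2 -> 'I_N2 -> 'I_N1 -> T)
    (lam mu : 'I_N1) (alp bet : 'I_N2) :
  flat_mx K (mxtens_index (lam, alp)) (mxtens_index (mu, bet))
  = K lam alp bet mu.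
Proof. by rewrite mxE !mxtens_indexK. Qed.

Lemma eq_flat_mx (T : Type) (K L : 'I_N1 -> 'I_N2 -> 'I_N2 -> 'I_N1 -> T) :
  flat_mx K = flat_mx L <->
  forall lam alp bet mu, K lam alp bet mu = L lam alp bet mu.
Proof.
split=> [eqKL lam alp bet mu|eqKL]; first by rewrite -!flat_mxE eqKL.
by apply/matrixP=> k l; rewrite !mxE eqKL.
Qed.

Lemma sum_mxtens_index (V : nmodType) (m n : nat) (F : 'I_(m * n) -> V) :
  \sum_k F k = \sum_(i < m) \sum_(j < n) F (mxtens_index (i, j)).
Proof.
rewrite pair_bigA /= (reindex (@mxtens_index m n)) /=.
  by apply: eq_bigr => -[].
by exists (@mxtens_unindex m n) => k _; rewrite (mxtens_indexK, mxtens_unindexK).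
Qed.

Lemma mul_flat_mxE (T : pzSemiRingType)
    (K L : 'I_N1 -> 'I_N2 -> 'I_N2 -> 'I_N1 -> T)
    (lam nu : 'I_N1) (alp gam : 'I_N2) :
  (flat_mx K *m flat_mx L) (mxtens_index (lam, alp)) (mxtens_index (nu, gam))
  = \sum_mu \sum_bet K lam alp bet mu * L mu bet gam nu.
Proof.
rewrite mxE sum_mxtens_index; apply: eq_bigr => mu _; apply: eq_bigr => bet _.
by rewrite !flat_mxE.
Qed.

Lemma scalar1_mxtensE (T : pzSemiRingType) (lam nu : 'I_N1) (alp gam : 'I_N2) :
  (1%:M : 'M[T]_(N1 * N2)) (mxtens_index (lam, alp)) (mxtens_index (nu, gam))
  = (lam == nu)%:R * (alp == gam)%:R.
Proof. by rewrite mxE (can_eq (@mxtens_indexK N1 N2)) -natrM mulnb. Qed.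

Lemma tensmx11 (T : pzRingType) :
  (1%:M : 'M[T]_N1) *t (1%:M : 'M[T]_N2) = 1%:M.
Proof.
apply/matrixP=> k l; case: (mxtens_indexP k) => lam alp.
case: (mxtens_indexP l) => mu bet.
by rewrite scalar1_mxtensE tensmxE !mxE.
Qed.

Lemma mul_flat_mx_eq1 (T : pzSemiRingType)
    (K L : 'I_N1 -> 'I_N2 -> 'I_N2 -> 'I_N1 -> T) :
  flat_mx K *m flat_mx L = 1%:M <->
  forall lam nu alp gam,
    \sum_mu \sum_bet K lam alp bet mu * L mu bet gam nu
    = (lam == nu)%:R * (alp == gam)%:R.
Proof.
split=> [eqKL lam nu alp gam|eqKL].
  by rewrite -mul_flat_mxE eqKL scalar1_mxtensE.
apply/matrixP=> k l; case: (mxtens_indexP k) => lam alp.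
case: (mxtens_indexP l) => nu gam.
by rewrite mul_flat_mxE scalar1_mxtensE.
Qed.

Lemma flat_mx_tens (T : pzRingType)
    (K : 'I_N1 -> 'I_N2 -> 'I_N2 -> 'I_N1 -> T)
    (p : nat) (A : 'I_p -> 'M[T]_N1) (B : 'I_p -> 'M[T]_N2) :
  flat_mx K = \sum_r A r *t B r <->
  forall lam alp bet mu, K lam alp bet mu = \sum_r A r lam mu * B r alp bet.
Proof.
split=> [eqK lam alp bet mu|eqK].
  by rewrite -flat_mxE eqK summxE; apply: eq_bigr => r _; rewrite tensmxE.
apply/matrixP=> k l; case: (mxtens_indexP k) => lam alp.
case: (mxtens_indexP l) => mu bet.
by rewrite flat_mxE eqK summxE; apply: eq_bigr => r _; rewrite tensmxE.
Qed.

(** An entry of the product [K L] is a sum over [bet] of products of first slices. Exchanging these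
    and regrouping gives a sum over [mu] of products of second slices, and a second exchange yields
    the entry of [L K]. *)
Lemma flat_mxC (T : comPzSemiRingType)
    (K L : 'I_N1 -> 'I_N2 -> 'I_N2 -> 'I_N1 -> T) :
  (forall alp bet gam del, comm_mx (slice1 K alp bet) (slice1 L gam del)) ->
  (forall lam mu nu rho, comm_mx (slice2 K lam mu) (slice2 L nu rho)) ->
  flat_mx K *m flat_mx L = flat_mx L *m flat_mx K.
Proof.
move=> comm1 comm2.
apply/matrixP=> k l; case: (mxtens_indexP k) => lam alp.
case: (mxtens_indexP l) => nu gam; rewrite !mul_flat_mxE.
transitivity (\sum_bet (slice1 K alp bet *m slice1 L bet gam) lam nu).
  rewrite exchange_big; apply: eq_bigr => bet _; rewrite mxE.
  by apply: eq_bigr => mu _; rewrite !mxE.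
transitivity (\sum_mu (slice2 K mu nu *m slice2 L lam mu) alp gam).
  under eq_bigr => bet _ do rewrite comm1 mxE.
  rewrite exchange_big; apply: eq_bigr => mu _; rewrite mxE.
  by apply: eq_bigr => bet _; rewrite !mxE mulrC.
apply: eq_bigr => mu _; rewrite comm2 mxE.
by apply: eq_bigr => bet _; rewrite !mxE.
Qed.

End FlatMatrix.

(** * Commutation and symmetry pass to linear combinations *)

Section Combinations.

Variables (T : comPzRingType) (n : nat).

(** Serves both directions of the theorem: factors are combinations of slices, and slices are
    combinations of factors. *)
Lemma comm_mx_lincomb (k l : nat) (a : 'I_k -> T) (c : 'I_l -> T)
    (X : 'I_k -> 'M[T]_n) (Y : 'I_l -> 'M[T]_n) :
  (forall i j, comm_mx (X i) (Y j)) ->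
  comm_mx (\sum_i a i *: X i) (\sum_j c j *: Y j).
Proof.
move=> commXY; apply: comm_mx_sum => j _.
apply/comm_mx_sym/comm_mx_sum => i _.
by rewrite /comm_mx -!scalemxAl -!scalemxAr commXY !scalerA mulrC.
Qed.

(** The sign [e] treats symmetric ([e = 1]) and antisymmetric ([e = -1]) matrices at once. *)
Lemma trmx_lincomb (k : nat) (e : T) (a : 'I_k -> T) (X : 'I_k -> 'M[T]_n) :
  (forall i, (X i)^T = e *: X i) ->
  (\sum_i a i *: X i)^T = e *: \sum_i a i *: X i.
Proof.
move=> trX; rewrite raddf_sum scaler_sumr; apply: eq_bigr => i _ /=.
by rewrite linearZ /= trX !scalerA mulrC.
Qed.

End Combinations.

(** * Minimal-rank tensor decomposition over a field *)

Section TensorDecomposition.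

Variables (F : fieldType) (N1 N2 : nat).
Variable K : 'I_N1 -> 'I_N2 -> 'I_N2 -> 'I_N1 -> F.

(* A full rank factorization of the N1^2 x N2^2 realignment of K: the factors
   have independent columns, resp. rows, and lie in the span of the slices. *)
Lemma tensor_rank_decomposition :
  exists (p : nat) (A : 'I_p -> 'M[F]_N1) (B : 'I_p -> 'M[F]_N2),
    [/\ forall lam alp bet mu,
          K lam alp bet mu = \sum_r A r lam mu * B r alp bet,
        free [tuple A r | r < p], free [tuple B r | r < p],
        exists c : 'I_p -> 'I_(N2 * N2) -> F, forall r,
          A r = \sum_l c r l *: slice1 K (mxtens_unindex l).1 (mxtens_unindex l).2
      & exists d : 'I_p -> 'I_(N1 * N1) -> F, forall r,
          B r = \sum_l d r l *: slice2 K (mxtens_unindex l).1 (mxtens_unindex l).2].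
Proof.
pose M : 'M[F]_(N1 * N1, N2 * N2) :=
  \matrix_(k, l) K (mxtens_unindex k).1 (mxtens_unindex l).1
                   (mxtens_unindex l).2 (mxtens_unindex k).2.
exists (\rank M), (fun r => \matrix_(lam, mu) col_base M (mxtens_index (lam, mu)) r).
exists (fun r => \matrix_(alp, bet) row_base M r (mxtens_index (alp, bet))).
(* Both full-rank factors have one-sided inverses. Hence the columns of [col_base M] are
   combinations of the columns of [M], which are the first slices of [K]; likewise the rows of
   [row_base M] are combinations of the second slices. *)
have colE : col_base M = M *m pinvmx (row_base M).
  by rewrite -[LHS]mulmx1 -(mulmxVp (row_base_free M)) mulmxA mulmx_base.
have rowE : row_base M = pinvmx (col_base M) *m M.
  by rewrite -[LHS]mul1mx -(mulVpmx (col_base_full M)) -mulmxA mulmx_base.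
split.
- move=> lam alp bet mu.
  transitivity (M (mxtens_index (lam, mu)) (mxtens_index (alp, bet))).
    by rewrite mxE !mxtens_indexK.
  have /matrixP/(_ (mxtens_index (lam, mu)) (mxtens_index (alp, bet))) <- :=
    mulmx_base M.
  by rewrite mxE; apply: eq_bigr => r _; rewrite !mxE.
- apply/freeP => k sum0 i.
  (* A linear relation between the [A r] is a kernel vector of [col_base M], which is left
     invertible. *)
  have col0 : col_base M *m (\col_r k r) = 0.
    apply/matrixP=> x y; case: (mxtens_indexP x) => lam mu.
    move/matrixP/(_ lam mu): sum0; rewrite summxE !mxE => sum0.
    rewrite -[RHS]sum0; apply: eq_bigr => r _.
    by rewrite !mxE -tnth_nth tnth_mktuple !mxE mulrC.
  have : \col_r k r = 0.
    by rewrite -[LHS]mul1mx -(mulVpmx (col_base_full M)) -mulmxA col0 mulmx0.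
  by move/colP/(_ i); rewrite !mxE.
- apply/freeP => k sum0 i.
  have row0 : (\row_r k r) *m row_base M = 0.
    apply/matrixP=> x y; case: (mxtens_indexP y) => alp bet.
    move/matrixP/(_ alp bet): sum0; rewrite summxE !mxE => sum0.
    rewrite -[RHS]sum0; apply: eq_bigr => r _.
    by rewrite !mxE -tnth_nth tnth_mktuple !mxE.
  have : \row_r k r = 0.
    by rewrite -[LHS]mulmx1 -(mulmxVp (row_base_free M)) mulmxA row0 mul0mx.
  by move/rowP/(_ i); rewrite !mxE.
- exists (fun r l => pinvmx (row_base M) l r) => r; apply/matrixP=> lam mu.
  rewrite mxE colE mxE summxE; apply: eq_bigr => l _.
  by rewrite !mxE mxtens_indexK mulrC.
- exists (fun r l => pinvmx (col_base M) r l) => r; apply/matrixP=> alp bet.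
  rewrite mxE rowE mxE summxE; apply: eq_bigr => l _.
  by rewrite !mxE mxtens_indexK.
Qed.

End TensorDecomposition.

(** * Complex matrices split into real and imaginary parts *)

Section ComplexMatrix.

Variables (R : realType) (n : nat).
Implicit Types U V : 'M[R]_n.

Definition complex_mx U V : 'M[R[i]]_n :=
  real_mx_to_complex U + 'i%C *: real_mx_to_complex V.

Lemma complex_mxE U V x y : complex_mx U V x y = U x y +i* V x y.
Proof.
by rewrite !mxE; apply/eqP; rewrite eq_complex /= !(mul0r, mul1r, mulr0) /=
   !(subr0, addr0, add0r) !eqxx.
Qed.

Lemma complex_mx_inj U V U' V' :
  complex_mx U V = complex_mx U' V' <-> U = U' /\ V = V'.
Proof.
split=> [eqUV|[-> ->]//].
by split; apply/matrixP=> x y; move/matrixP/(_ x y): eqUV;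
  rewrite !complex_mxE => -[].
Qed.

Lemma mul_complex_mx U V U' V' :
  complex_mx U V *m complex_mx U' V' =
  complex_mx (U *m U' - V *m V') (U *m V' + V *m U').
Proof.
rewrite /complex_mx /real_mx_to_complex !(mulmxDl, mulmxDr).
rewrite -!scalemxAl -!scalemxAr !scalerA -!map_mxM -expr2 sqr_i scaleN1r.
by rewrite map_mxB map_mxD scalerDr [X in _ + X]addrC addrACA.
Qed.

Lemma complex_mx1 : complex_mx 1%:M 0 = 1%:M.
Proof. by rewrite /complex_mx /real_mx_to_complex map_mx1 map_mx0 scaler0 addr0. Qed.

(** Adding the two equations gives [2a = 2c], and 2 is invertible. *)
Lemma addr_subr_mx_inj (a b c d : 'M[R]_n) :
  a - b = c - d -> a + b = c + d -> a = c /\ b = d.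
Proof.
move=> eqB eqD; suff ac : a = c by split=> //; apply: (addrI c); rewrite -{1}ac.
have two_neq0 : 2%:R != 0 :> R by rewrite pnatr_eq0.
apply: (scalerI two_neq0); rewrite !scaler_nat !mulr2n.
have dbl (x y : 'M[R]_n) : x + x = (x - y) + (x + y).
  by rewrite addrACA addNr addr0.
by rewrite (dbl a b) (dbl c d) eqB eqD.
Qed.

(** Commuting with both [U + iV] and [U - iV] fixes the sum and the difference of the terms [UU']
    and [VV'] (real parts), and of [UV'] and [VU'] (imaginary parts), so the terms separate. *)
Lemma comm_complex_mx U V U' V' :
  comm_mx (complex_mx U V) (complex_mx U' V') ->
  comm_mx (complex_mx U (- V)) (complex_mx U' V') ->
  [/\ comm_mx U U', comm_mx U V' & comm_mx V V'].
Proof.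
rewrite /comm_mx !mul_complex_mx => /complex_mx_inj[re1 im1] /complex_mx_inj[].
rewrite !(mulmxN, mulNmx) !opprK => re2 im2.
have [-> ->] := addr_subr_mx_inj re1 re2.
(* The right-hand sides are reordered so that [V' U] faces [U V']. *)
rewrite [RHS]addrC in im1; rewrite [RHS]addrC in im2.
by have [-> _] := addr_subr_mx_inj im2 im1.
Qed.

Lemma re_im_comm_complex_mx U V U' V' :
  comm_mx U U' -> comm_mx U V' -> comm_mx V U' -> comm_mx V V' ->
  comm_mx (complex_mx U V) (complex_mx U' V').
Proof.
move=> UU UV VU VV; rewrite /comm_mx !mul_complex_mx UU UV VU VV.
by congr complex_mx; rewrite addrC.
Qed.

End ComplexMatrix.

(** * The defining conditions in terms of slices *)

Section NoncommutativeProduct.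

Variables (R : realType) (N1 N2 : nat) (P : coeff_family R N1 N2).

Definition re_coeff lam alp bet mu : R := complex.Re (P lam alp bet mu).
Definition im_coeff lam alp bet mu : R := complex.Im (P lam alp bet mu).

Local Notation K := re_coeff.
Local Notation L := im_coeff.

Lemma slice1_complex alp bet :
  slice1 P alp bet = complex_mx (slice1 K alp bet) (slice1 L alp bet).
Proof. by apply/matrixP=> x y; rewrite complex_mxE !mxE /K /L; case: (P _ _ _ _). Qed.

Lemma slice2_complex lam mu :
  slice2 P lam mu = complex_mx (slice2 K lam mu) (slice2 L lam mu).
Proof. by apply/matrixP=> x y; rewrite complex_mxE !mxE /K /L; case: (P _ _ _ _). Qed.

Lemma slice1_conj alp bet :
  slice1 (conj_coeff P) alp bet =
  complex_mx (slice1 K alp bet) (- slice1 L alp bet).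
Proof.
by apply/matrixP=> x y; rewrite complex_mxE !mxE /K /L /conj_coeff; case: (P _ _ _ _).
Qed.

Lemma slice2_conj lam mu :
  slice2 (conj_coeff P) lam mu =
  complex_mx (slice2 K lam mu) (- slice2 L lam mu).
Proof.
by apply/matrixP=> x y; rewrite complex_mxE !mxE /K /L /conj_coeff; case: (P _ _ _ _).
Qed.

Lemma flat_mx_complex : flat_mx P = complex_mx (flat_mx K) (flat_mx L).
Proof. by apply/matrixP=> x y; rewrite complex_mxE !mxE /K /L; case: (P _ _ _ _). Qed.

Lemma flat_mx_conj : flat_mx (conj_coeff P) = complex_mx (flat_mx K) (- flat_mx L).
Proof.
by apply/matrixP=> x y; rewrite complex_mxE !mxE /K /L /conj_coeff; case: (P _ _ _ _).
Qed.

Lemma hat_flat_mx : hat P = flat_mx P.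
Proof.
apply/matrixP=> k l; rewrite !mxE.
by case: (mxtens_unindex k) (mxtens_unindex l) => [? ?] [].
Qed.

Lemma yang_baxter1_comm (Q Q' : coeff_family R N1 N2) :
  yang_baxter1 Q Q' <->
  forall alp gam bet del, comm_mx (slice1 Q alp gam) (slice1 Q' bet del).
Proof.
split=> [yb alp gam bet del|commQ lam mu alp bet gam del].
  apply/matrixP=> lam mu; rewrite !mxE.
  by under eq_bigr do rewrite !mxE; under [RHS]eq_bigr do rewrite !mxE; apply: yb.
move/matrixP/(_ lam mu): (commQ alp gam bet del); rewrite !mxE.
by under eq_bigr do rewrite !mxE; under [RHS]eq_bigr do rewrite !mxE.
Qed.

Lemma yang_baxter2_comm (Q Q' : coeff_family R N1 N2) :
  yang_baxter2 Q Q' <->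
  forall lam nu mu rho, comm_mx (slice2 Q lam nu) (slice2 Q' mu rho).
Proof.
split=> [yb lam nu mu rho|commQ lam mu nu rho alp bet].
  apply/matrixP=> alp bet; rewrite !mxE.
  by under eq_bigr do rewrite !mxE; under [RHS]eq_bigr do rewrite !mxE; apply: yb.
move/matrixP/(_ alp bet): (commQ lam nu mu rho); rewrite !mxE.
by under eq_bigr do rewrite !mxE; under [RHS]eq_bigr do rewrite !mxE.
Qed.

Definition commuting_slices :=
  [/\ forall alp bet gam del, comm_mx (slice1 K alp bet) (slice1 K gam del),
      forall alp bet gam del, comm_mx (slice1 K alp bet) (slice1 L gam del)
    & forall alp bet gam del, comm_mx (slice1 L alp bet) (slice1 L gam del)] /\
  [/\ forall lam mu nu rho, comm_mx (slice2 K lam mu) (slice2 K nu rho),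
      forall lam mu nu rho, comm_mx (slice2 K lam mu) (slice2 L nu rho)
    & forall lam mu nu rho, comm_mx (slice2 L lam mu) (slice2 L nu rho)].

Lemma yang_baxter_slices : yang_baxter P <-> commuting_slices.
Proof.
split=> [|[[KK KL LL] [KK2 KL2 LL2]]].
  case=> -[/yang_baxter1_comm PP _ /yang_baxter1_comm cPP].
  case=> /yang_baxter2_comm PP2 _ /yang_baxter2_comm PcP2.
  have split1 alp bet gam del : [/\ comm_mx (slice1 K alp bet) (slice1 K gam del),
      comm_mx (slice1 K alp bet) (slice1 L gam del)
    & comm_mx (slice1 L alp bet) (slice1 L gam del)].
    by apply: comm_complex_mx; rewrite -?slice1_conj -!slice1_complex.
  have split2 lam mu nu rho : [/\ comm_mx (slice2 K lam mu) (slice2 K nu rho),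
      comm_mx (slice2 K lam mu) (slice2 L nu rho)
    & comm_mx (slice2 L lam mu) (slice2 L nu rho)].
    (* The mixed condition on second slices has the conjugate as its right factor, whereas
       [comm_complex_mx] expects it on the left; hence the flip by symmetry. *)
    apply: comm_complex_mx; rewrite -?slice2_conj -!slice2_complex //.
    exact/comm_mx_sym.
  by split; split=> i j k l;
    first [by case: (split1 i j k l) | by case: (split2 i j k l)].
(* Exchanging the two slices turns commutation of [K] with [L] into that of [L] with [K], the fourth
   relation required to recombine complex slices. *)
have LK alp bet gam del := comm_mx_sym (KL alp bet gam del).
have LK2 lam mu nu rho := comm_mx_sym (KL2 lam mu nu rho).
split; split; first [apply/yang_baxter1_comm | apply/yang_baxter2_comm] => *.
all: rewrite ?(slice1_complex, slice2_complex, slice1_conj, slice2_conj).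
all: apply: re_im_comm_complex_mx; do ?[apply: comm_mxN | apply/comm_mx_sym/comm_mxN].
all: by [].
Qed.

Definition partial_tr1 (Q : coeff_family R N1 N2) : coeff_family R N1 N2 :=
  fun lam alp bet mu => Q mu alp bet lam.

Definition partial_tr2 (Q : coeff_family R N1 N2) : coeff_family R N1 N2 :=
  fun lam alp bet mu => Q lam bet alp mu.

Lemma reality_flat_mx :
  reality P <-> flat_mx (conj_coeff P) *m flat_mx P = 1%:M.
Proof.
by rewrite mul_flat_mx_eq1; split=> real *; exact: real.
Qed.

(** Each centrality sum contracts an upper index with an upper index. Transposing the left factor in
    that tensor slot makes the sum an ordinary matrix product. *)
Lemma centrality_flat_mx :
  centrality P <->
  flat_mx (partial_tr1 P) *m flat_mx P = 1%:M /\
  flat_mx (partial_tr2 P) *m flat_mx P = 1%:M.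
Proof.
rewrite !mul_flat_mx_eq1 /partial_tr1 /partial_tr2; split=> -[c1 c2]; split.
- by move=> lam nu alp gam; rewrite c1 mulrC [nu == _]eq_sym.
- by move=> lam nu alp gam; rewrite exchange_big c2.
- by move=> gam alp nu mu; rewrite c1 mulrC [nu == _]eq_sym.
- by move=> lam mu bet gam; rewrite exchange_big c2.
Qed.

Definition symmetric_slices :=
  [/\ forall alp bet, (slice1 K alp bet)^T = slice1 K alp bet,
      forall lam mu, (slice2 K lam mu)^T = slice2 K lam mu,
      forall alp bet, (slice1 L alp bet)^T = - slice1 L alp bet
    & forall lam mu, (slice2 L lam mu)^T = - slice2 L lam mu].

(** Conjugation keeps the real part and negates the imaginary part; comparing the two parts
    entrywise gives the signs. *)
Lemma partial_tr_slices :
  (flat_mx (partial_tr1 P) = flat_mx (conj_coeff P) /\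
   flat_mx (partial_tr2 P) = flat_mx (conj_coeff P)) <-> symmetric_slices.
Proof.
rewrite !eq_flat_mx /partial_tr1 /partial_tr2 /conj_coeff.
split=> [[tr1 tr2]|[sK1 sK2 sL1 sL2]].
  split=> i j; apply/matrixP=> x y; rewrite !mxE /K /L.
  - by rewrite (tr1 x i j y); case: (P x i j y).
  - by rewrite (tr2 i x y j); case: (P i x y j).
  - by rewrite (tr1 x i j y); case: (P x i j y).
  - by rewrite (tr2 i x y j); case: (P i x y j).
have sK1' lam alp bet mu : K mu alp bet lam = K lam alp bet mu.
  by move/matrixP/(_ lam mu): (sK1 alp bet); rewrite !mxE.
have sK2' lam alp bet mu : K lam bet alp mu = K lam alp bet mu.
  by move/matrixP/(_ alp bet): (sK2 lam mu); rewrite !mxE.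
have sL1' lam alp bet mu : L mu alp bet lam = - L lam alp bet mu.
  by move/matrixP/(_ lam mu): (sL1 alp bet); rewrite !mxE.
have sL2' lam alp bet mu : L lam bet alp mu = - L lam alp bet mu.
  by move/matrixP/(_ alp bet): (sL2 lam mu); rewrite !mxE.
split=> lam alp bet mu.
  move: (sK1' lam alp bet mu) (sL1' lam alp bet mu); rewrite /K /L.
  by case: (P mu _ _ _) (P lam _ _ _) => [? ?] [? ?] /= -> ->.
move: (sK2' lam alp bet mu) (sL2' lam alp bet mu); rewrite /K /L.
by case: (P _ bet _ _) (P _ alp _ _) => [? ?] [? ?] /= -> ->.
Qed.

Lemma noncommutative_euclidean_product_slices :
  noncommutative_euclidean_product P <->
  [/\ commuting_slices, symmetric_slices
    & flat_mx K *m flat_mx K + flat_mx L *m flat_mx L = 1%:M].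
Proof.
(* The real part is the normalization and the imaginary part is a commutator. *)
have prodE : flat_mx (conj_coeff P) *m flat_mx P =
    complex_mx (flat_mx K *m flat_mx K + flat_mx L *m flat_mx L)
               (flat_mx K *m flat_mx L - flat_mx L *m flat_mx K).
  by rewrite flat_mx_conj flat_mx_complex mul_complex_mx !mulNmx opprK.
split=> [[/reality_flat_mx real /yang_baxter_slices comms]|].
  move=> /centrality_flat_mx[c1 c2].
  (* Uniqueness of the inverse: by reality the conjugate is a left inverse of a square matrix, hence
     also a right one. *)
  have inv Q : flat_mx Q *m flat_mx P = 1%:M -> flat_mx Q = flat_mx (conj_coeff P).
    move=> invQ; by rewrite -[LHS]mulmx1 -(mulmx1C real) mulmxA invQ mul1mx.
  split=> //; first by apply/partial_tr_slices; split; apply: inv.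
  by move: real; rewrite prodE -complex_mx1 => /complex_mx_inj[].
case=> comms /partial_tr_slices[tr1 tr2] norm.
have real : flat_mx (conj_coeff P) *m flat_mx P = 1%:M.
  (* The commutator vanishes because the slices of [K] commute with those of [L]. *)
  case: comms => -[_ KL1 _] [_ KL2 _].
  by rewrite prodE norm (flat_mxC KL1 KL2) subrr complex_mx1.
split; first exact/reality_flat_mx.
  exact/yang_baxter_slices.
by apply/centrality_flat_mx; rewrite tr1 tr2.
Qed.

End NoncommutativeProduct.

(** * From slices to tensor factors and back *)

Theorem theorem4p3 (R : realType) (N1 N2 : nat) (P : coeff_family R N1 N2) :
  noncommutative_euclidean_product P <->
  exists (p q : nat) (A : 'I_p -> 'M[R]_N1) (B : 'I_p -> 'M[R]_N2)
         (C : 'I_q -> 'M[R]_N1) (D : 'I_q -> 'M[R]_N2),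
    let S : 'M[R]_(N1 * N2) := \sum_(r < p) A r *t B r in
    let T : 'M[R]_(N1 * N2) := \sum_(a < q) C a *t D a in
    hat P = real_mx_to_complex S + 'i%C *: real_mx_to_complex T /\
    [/\ forall r, symmetric_mx (A r),
        forall r, symmetric_mx (B r),
        forall a, antisymmetric_mx (C a)
      & forall a, antisymmetric_mx (D a)] /\
    [/\ linearly_independent A, linearly_independent B,
        linearly_independent C & linearly_independent D] /\
    [/\ forall r s, comm_mx (A r) (A s),
        forall r a, comm_mx (A r) (C a)
      & forall a b, comm_mx (C a) (C b)] /\
    [/\ forall r s, comm_mx (B r) (B s),
        forall r a, comm_mx (B r) (D a)
      & forall a b, comm_mx (D a) (D b)] /\
    S *m S + T *m T = 1%:M *t 1%:M.

Proof.
split=> [/noncommutative_euclidean_product_slices|].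
  case=> -[[KK1 KL1 LL1] [KK2 KL2 LL2]] [sK1 sK2 sL1 sL2] norm.
  (* The real and imaginary parts are decomposed separately over the reals; [p] and [q] are the
     ranks of their realignments. *)
  have [p [A [B [KE freeA freeB [c AE] [d BE]]]]] :=
    tensor_rank_decomposition (re_coeff P).
  have [q [C [D [LE freeC freeD [e CE] [f DE]]]]] :=
    tensor_rank_decomposition (im_coeff P).
  exists p, q, A, B, C, D => S T.
  have SE : flat_mx (re_coeff P) = S by apply/flat_mx_tens.
  have TE : flat_mx (im_coeff P) = T by apply/flat_mx_tens.
  split; first by rewrite hat_flat_mx flat_mx_complex SE TE.
  split.
    (* Each factor is a combination of slices, with sign 1 for the real part and -1 for the
       imaginary part. *)
    split=> r; rewrite ?/symmetric_mx ?/antisymmetric_mx.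
    - by rewrite AE (@trmx_lincomb _ _ _ 1) ?scale1r // => i; rewrite scale1r.
    - by rewrite BE (@trmx_lincomb _ _ _ 1) ?scale1r // => i; rewrite scale1r.
    - by rewrite CE (@trmx_lincomb _ _ _ (-1)) ?scaleN1r // => i; rewrite scaleN1r.
    - by rewrite DE (@trmx_lincomb _ _ _ (-1)) ?scaleN1r // => i; rewrite scaleN1r.
  split; first by split.
  split; first by split=> r s; rewrite ?AE ?CE; apply: comm_mx_lincomb.
  split; first by split=> r s; rewrite ?BE ?DE; apply: comm_mx_lincomb.
  by rewrite -SE -TE norm tensmx11.
case=> p [q [A [B [C [D []]]]]].
set S := \sum_r A r *t B r; set T := \sum_a C a *t D a.
rewrite hat_flat_mx flat_mx_complex => /complex_mx_inj[SE TE].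
case=> -[symA symB antiC antiD] [_ [[AA AC CC] [[BB BD DD] norm]]].
have KE := (flat_mx_tens _ _ _).1 SE; have LE := (flat_mx_tens _ _ _).1 TE.
(* Freezing one pair of indices in the representation expands a slice in the factors of one slot,
   with the entries of the other factors as coefficients. *)
have K1 alp bet : slice1 (re_coeff P) alp bet = \sum_r B r alp bet *: A r.
  apply/matrixP=> lam mu; rewrite mxE KE summxE.
  by apply: eq_bigr => r _; rewrite mxE mulrC.
have K2 lam mu : slice2 (re_coeff P) lam mu = \sum_r A r lam mu *: B r.
  apply/matrixP=> alp bet; rewrite mxE KE summxE.
  by apply: eq_bigr => r _; rewrite mxE.
have L1 alp bet : slice1 (im_coeff P) alp bet = \sum_a D a alp bet *: C a.
  apply/matrixP=> lam mu; rewrite mxE LE summxE.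
  by apply: eq_bigr => a _; rewrite mxE mulrC.
have L2 lam mu : slice2 (im_coeff P) lam mu = \sum_a C a lam mu *: D a.
  apply/matrixP=> alp bet; rewrite mxE LE summxE.
  by apply: eq_bigr => a _; rewrite mxE.
apply/noncommutative_euclidean_product_slices; split.
- by split; split=> *; rewrite ?K1 ?K2 ?L1 ?L2; apply: comm_mx_lincomb.
- split=> *; rewrite ?K1 ?K2 ?L1 ?L2.
  + by rewrite (@trmx_lincomb _ _ _ 1) ?scale1r // => i; rewrite scale1r symA.
  + by rewrite (@trmx_lincomb _ _ _ 1) ?scale1r // => i; rewrite scale1r symB.
  + by rewrite (@trmx_lincomb _ _ _ (-1)) ?scaleN1r // => i; rewrite scaleN1r antiC.
  + by rewrite (@trmx_lincomb _ _ _ (-1)) ?scaleN1r // => i; rewrite scaleN1r antiD.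
- by rewrite SE TE norm tensmx11.
Qed.
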